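(* For every integer $k\ge2$ the $k$-bonacci word is strongly echoing.
   Context: $\mathbb N=\{0,1,2,\ldots\}$. For $k\ge2$ and $\Sigma=\{0,\ldots,k-1\}$, the $k$-bonacci morphism is the semigroup homomorphism $\varphi:\Sigma^+\to\Sigma^+$ on non-empty finite words given by $\varphi(a)=0\,(a+1)$ (a word of length two) for $0\le a\le k-2$ and $\varphi(k-1)=0$. The $k$-bonacci word is the infinite word $\boldsymbol u=\lim_{n\to\infty}\varphi^n(0)\in\Sigma^\omega$. For non-empty intervals $I,J\subseteq\mathbb N$ (sets of consecutive integers) write $I<J$ if $a<b$ for all $a\in I,b\in J$, and $d(I,J)=\min\{|a-b|:a\in I,b\in J\}$. For a non-empty finite set $S\subseteq\mathbb N$, $\mathrm{den}(S)=|S|/\max(S)$. Write $f\ll g$ (equivalently $g\gg f$) if there are positive constants $n_0,c_1$ with $f(n)\le c_1g(n)$ for all $n\ge n_0$; write $f\asymp g$ if $f\ll g$ and $g\ll f$. A word $\boldsymbol u=u_0u_1u_2\ldots$ over a finite alphabet $\{0,\ldots,b-1\}$ (letters regarded as integers) is strongly echoing if, given $\varepsilon>0$, for all $n\in\mathbb N$ there exist integers $0\le r_n<s_n$ and a sequence of non-empty intervals $\{0\}=I_{n,0}<I_{n,1}<I_{n,2}<\cdots$ such that: 1. (Covering) $\{i\in\mathbb N:u_{i+s_n}\ne u_{i+r_n}\}\subseteq\bigcup_{j=1}^\infty I_{n,j}$; 2. (Density) $\mathrm{den}\big(\bigcup_{j=1}^\delta I_{n,j}\big)\le\varepsilon$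 for all sufficiently large $\delta$ and $n$; 3. (Expanding gaps) $s_n<s_{n+1}$ for all $n$, and as $n\to\infty$, $s_n-r_n\gg s_n$ and $d(I_{n,j},I_{n,j+1})\asymp s_n$, where the implied constant is independent of $j\in\{0,1,2,\ldots\}$; 4. (Non-vanishing) for all $\beta\in\overline{\mathbb Q}$ such that $|\beta|>1$ there exist $1\le j_0<j_1$ such that for all $n\in\mathbb N$ and $j\in\{j_0,j_1\}$ we have $\sum_{i\in I_{n,j}}(u_{i+s_n}-u_{i+r_n})\beta^{-i}\ne0$. *)

(* Defs.v *)
From HB Require Import structures.
From mathcomp Require Import all_boot all_order all_algebra all_field.
From mathcomp Require Import finmap.
From mathcomp Require Import reals.

Set Implicit Arguments.
Unset Strict Implicit.
Unset Printing Implicit Defensive.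

Import Order.TTheory GRing.Theory Num.Theory.
Local Open Scope ring_scope.

(* Finite sets of naturals are {fset nat}, the field of algebraic numbers with
   the complex modulus is algC, and real constants live in a realType. *)

Section KBonacci.
Variables (k : nat) (hk : (2 <= k)%N).

Definition letter0 : 'I_k := Ordinal (ltnW hk).

(* [insub a.+1] is [Some (a + 1)] when a <= k - 2 and [None] when a = k - 1. *)
Definition kbonacci_letter (a : 'I_k) : seq 'I_k :=
  if insub a.+1 is Some a' then [:: letter0; a'] else [:: letter0].

Definition kbonacci_morphism (w : seq 'I_k) : seq 'I_k :=
  flatten [seq kbonacci_letter a | a <- w].

End KBonacci.

(* Convergence of finite words to an infinite word: every position is
   eventually defined and equal to the corresponding letter of the limit. *)
Definition word_limit (T : Type) (w : nat -> seq T) (u : nat -> T) : Prop :=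
  forall i, exists N, forall n, (N <= n)%N -> onth (w n) i = Some (u i).

Definition is_kbonacci_word (k : nat) (hk : (2 <= k)%N) (u : nat -> 'I_k) :
    Prop :=
  word_limit (fun n => iter n (kbonacci_morphism hk) [:: letter0 hk]) u.

Definition is_interval (I : {fset nat}) : Prop :=
  forall a b c : nat, a \in I -> c \in I -> (a <= b <= c)%N -> b \in I.

Definition set_lt (I J : {fset nat}) : Prop :=
  forall a b : nat, a \in I -> b \in J -> (a < b)%N.

Definition fset_max (S : {fset nat}) : nat := \max_(i <- S) i.

(* The default value bounds every |a - b| from above, so for non-empty I and J
   this is the minimum of the |a - b|. *)
Definition set_dist (I J : {fset nat}) : nat :=
  \big[minn/(fset_max I + fset_max J)%N]_(a <- I)
    \big[minn/(fset_max I + fset_max J)%N]_(b <- J) `|a%:Z - b%:Z|%N.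

Lemma set_dist_le (I J : {fset nat}) (a b : nat) :
  a \in I -> b \in J -> (set_dist I J <= `|a%:Z - b%:Z|)%N.
Proof.
move=> aI bJ; have h (D : nat) (F : nat -> nat) (S : seq nat) x :
    x \in S -> (\big[minn/D]_(y <- S) F y <= F x)%N.
  elim: S => // y S IH; rewrite inE big_cons geq_min => /orP[/eqP->|/IH ->].
    by rewrite leqnn.
  by rewrite orbT.
exact: leq_trans (h _ _ _ _ aI) (h _ _ _ _ bJ).
Qed.

Lemma set_dist_attained (I J : {fset nat}) : I != fset0 -> J != fset0 ->
  exists a b : nat, [/\ a \in I, b \in J & set_dist I J = `|a%:Z - b%:Z|%N].
Proof.
have h (D : nat) (F : nat -> nat) (S : {fset nat}) : S != fset0 ->
    (forall x, x \in S -> (F x <= D)%N) ->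
    exists2 x, x \in S & \big[minn/D]_(y <- S) F y = F x.
  move=> /fset0Pn[x0 x0S] leD.
  have : \big[minn/D]_(y <- S) F y = D \/
         exists2 x, x \in S & \big[minn/D]_(y <- S) F y = F x.
    rewrite big_seq; elim/big_ind: _ => [|m n IHm IHn|x xS]; first by left.
      by rewrite /minn; case: ifP.
    by right; exists x.
  case=> // E; exists x0 => //; rewrite E; apply/eqP.
  rewrite eqn_leq leD // andbT -{1}E; move: x0S.
  rewrite -[x0 \in S]/(x0 \in enum_fset S).
  elim: (enum_fset S) => // y s IH; rewrite inE big_cons geq_min.
  by case/orP=> [/eqP->|/IH ->]; rewrite ?leqnn ?orbT.
have mx (S : {fset nat}) x : x \in S -> (x <= fset_max S)%N.
  by move=> xS; apply: (leq_bigmax_seq (F := id)).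
move=> I0 J0; set D := (fset_max I + fset_max J)%N.
have leD a b : a \in I -> b \in J -> (`|a%:Z - b%:Z| <= D)%N.
  move=> /mx aI /mx bJ; apply: leq_trans (leq_add aI bJ).
  by have := leqD_dist a%:Z 0 b%:Z; rewrite subr0 sub0r abszN.
have K a : a \in I -> exists2 b, b \in J &
    \big[minn/D]_(b <- J) `|a%:Z - b%:Z|%N = `|a%:Z - b%:Z|%N.
  by move=> aI; apply: (h _ (fun b => `|a%:Z - b%:Z|%N)) => // b; apply: leD.
have [|a aI E] := h D (fun a => \big[minn/D]_(b <- J) `|a%:Z - b%:Z|%N) I I0.
  by move=> a aI; have [b bJ ->] := K a aI; apply: leD.
by have [b bJ E'] := K a aI; exists a, b; split=> //; rewrite -E' -E.
Qed.

Section Asymptotics.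
Variable R : realType.

Definition den (S : {fset nat}) : R := #|` S|%:R / (fset_max S)%:R.

(* f << g for families indexed by J, with constants independent of the index. *)
Definition unif_ll (J : Type) (f g : J -> nat -> R) : Prop :=
  exists (n0 : nat) (c1 : R), [/\ (0 < n0)%N, 0 < c1 &
    forall j n, (n0 <= n)%N -> f j n <= c1 * g j n].

Definition ll (f g : nat -> R) : Prop :=
  exists (n0 : nat) (c1 : R), [/\ (0 < n0)%N, 0 < c1 &
    forall n, (n0 <= n)%N -> f n <= c1 * g n].

Definition unif_asymp (J : Type) (f g : J -> nat -> R) : Prop :=
  unif_ll f g /\ unif_ll g f.

Section Echoing.
Variables (b : nat) (u : nat -> 'I_b).
Variables (r s : nat -> nat) (I : nat -> nat -> {fset nat}).

Definition covering : Prop :=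
  forall n i, u (i + s n)%N != u (i + r n)%N ->
    exists2 j, (1 <= j)%N & i \in I n j.

Definition density (eps : R) : Prop :=
  exists delta0 n0 : nat, forall delta n, (delta0 <= delta)%N -> (n0 <= n)%N ->
    den (\big[fsetU/fset0]_(1 <= j < delta.+1) I n j) <= eps.

Definition expanding_gaps : Prop :=
  [/\ forall n, (s n < s n.+1)%N,
      ll (fun n => (s n)%:R) (fun n => (s n)%:R - (r n)%:R) &
      unif_asymp (fun j n => (set_dist (I n j) (I n j.+1))%:R)
                 (fun _ n => (s n)%:R)].

Definition non_vanishing : Prop :=
  forall beta : algC, 1 < `|beta| ->
    exists j0 j1 : nat, [/\ (1 <= j0)%N, (j0 < j1)%N &
      forall n j, j = j0 \/ j = j1 ->
        \sum_(i <- I n j)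
          ((u (i + s n)%N)%:R - (u (i + r n)%N)%:R) * beta ^- i != 0].

End Echoing.

(* Finite sets suffice for the intervals: each one lies strictly below the next
   one, which is non-empty. *)
Definition strongly_echoing (b : nat) (u : nat -> 'I_b) : Prop :=
  forall eps : R, 0 < eps ->
    exists (r s : nat -> nat) (I : nat -> nat -> {fset nat}),
      [/\ forall n, (r n < s n)%N,
          forall n, I n 0%N = [fset 0%N]%fset,
          forall n j, I n j != fset0 /\ is_interval (I n j) &
          forall n j, set_lt (I n j) (I n j.+1)]
      /\ [/\ covering u r s I, density I eps, expanding_gaps r s I &
             non_vanishing u r s I].

End Asymptotics.

Section Existence.
Variables (k : nat) (hk : (2 <= k)%N).
Let w n := iter n (kbonacci_morphism hk) [:: letter0 hk].

Lemma kbonacci_word_step n : exists a t, w n.+1 = w n ++ a :: t.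
Proof.
elim: n => [|n [a [t IH]]].
  exists (Ordinal hk), [::].
  by rewrite /w /kbonacci_morphism /= cats0 /kbonacci_letter insubT.
have -> : w n.+2 = kbonacci_morphism hk (w n.+1) by [].
rewrite IH /kbonacci_morphism map_cat flatten_cat /= -/(kbonacci_morphism _ _).
rewrite -[kbonacci_morphism hk (w n)]/(w n.+1) -IH {1}/kbonacci_letter.
by case: insub => [a'|]; eexists; eexists; reflexivity.
Qed.

Lemma kbonacci_word_exists : exists u, is_kbonacci_word hk u.
Proof.
have sz n : (n < size (w n))%N.
  elim: n => // n IH; have [a [t ->]] := kbonacci_word_step n.
  by rewrite size_cat /= addnS ltnS (leq_trans IH) // leq_addr.
have st i m d : (i < size (w m))%N ->
    onth (w (m + d)) i = onth (w m) i /\ (i < size (w (m + d)))%N.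
  move=> lt; elim: d => [|d [IH IHs]]; first by rewrite addn0.
  rewrite addnS; have [a [t ->]] := kbonacci_word_step (m + d).
  by rewrite onth_cat IHs size_cat ltn_addr.
exists (fun i => nth (letter0 hk) (w i) i) => i; exists i => n /subnKC <-.
have [E _] := st i i (n - i)%N (sz i); rewrite -/(w _) E.
rewrite -odflt_onth; case: onth (onthTE (w i) i) => //=.
by rewrite sz.
Qed.

End Existence.

(* Main.v *)
(* Write phi for the morphism, w_n = phi^n (0), t_n = |w_n|, and compare u with
   its shift by s_n = t_(M+n) (so r_n = 0), for a large fixed M.

   Few mismatches.  The prefix 0 q of u followed by a 0 and the corresponding
   prefix q 0 of the shift of u by one differ by moving 0 through q.  So one
   needs that the number h_n (y,c) of misaligned positions between phi^n (yc)
   and phi^n (cy) is o(t_n).  If y < c = k - d, then phi^d (yc) and phi^d (cy)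
   are X (y+d) X and X X (y+d), with X = w_(d-1) ... w_0, hence
   h_(n+d) (y,c) <= sum over the letters z of X of h_n (y+d,z).  This turns a
   bound t_n h_n (y,c) <= C |phi^n (y)| |phi^n (c)| into the same bound at n + d
   with C multiplied by 1 - 2^-k.

   Uniformity in n.  An aligned position at level M stays free of mismatches
   under every phi^n, so the intervals are images under phi^n of runs of
   positions containing all misaligned ones.  Non-vanishing requires intervals
   that are good for all n at once.  Since the algebraic numbers are countable,
   sparse zones t_(M+m), ..., t_(M+m) + t_(M+k) + 1 can be reserved for each
   beta: there, two consecutive intervals are separated by one aligned position
   t_(M+m) + t_(M+a), with 1 <= a <= k chosen according to n and beta.  If the
   first of these intervals had a vanishing sum for all a, then the values p_m
   of the words w_m at x = 1 / beta would satisfy p_m = v (1 - x^(t_m)) for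
   n+M <= m <= n+M+k, hence for all smaller m by
   w_(m+k+1) w_m = w_(m+k) w_(m+k); but p_0 = 0 and p_1 = x. *)

Require Import Defs.
From mathcomp Require Import all_boot all_order all_algebra all_field.
From mathcomp Require Import finmap.
From mathcomp Require Import reals.
From mathcomp Require Import boolp zify ring.

Set Implicit Arguments.
Unset Strict Implicit.
Unset Printing Implicit Defensive.

Import Order.TTheory GRing.Theory Num.Theory.

(** * Aligned positions of two words *)

Section Mismatches.
Local Open Scope nat_scope.

(* The abelian equivalence of the prefixes guarantees that the images of the
   two i-th letters under any morphism also start at the same position. *)
Definition aligned (A B : seq nat) i :=
  (nth 0 A i == nth 0 B i) && perm_eq (take i A) (take i B).

Definition mism (A B : seq nat) :=
  count (fun i => ~~ aligned A B i) (iota 0 (size A)).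

Lemma mism_refl A : mism A A = 0.
Proof.
rewrite /mism (eq_count (a2 := pred0)) ?count_pred0 // => i.
by rewrite /aligned eqxx perm_refl.
Qed.

Lemma mism_sym A B : size A = size B -> mism A B = mism B A.
Proof.
move=> sAB; rewrite /mism sAB; apply: eq_count => i.
by rewrite /aligned eq_sym perm_sym.
Qed.

Lemma mism_le_size A B : mism A B <= size A.
Proof. by rewrite /mism -[leqRHS](size_iota 0) count_size. Qed.

Lemma mism_trans B A C : size A = size B -> mism A C <= mism A B + mism B C.
Proof.
move=> sAB; rewrite /mism -sAB -count_predUI.
apply: leq_trans (leq_addr _ _); apply: sub_count => i /=.
rewrite -negb_and; apply: contra => /andP[/andP[/eqP e1 p1] /andP[/eqP e2 p2]].
by rewrite /aligned e1 e2 eqxx (perm_trans p1 p2).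
Qed.

(** Abelian-equivalent prefixes drop out of every later comparison, so alignment past them depends
    on [C] and [D] alone. *)
Lemma mism_cat A B C D : perm_eq A B ->
  mism (A ++ C) (B ++ D) = mism A B + mism C D.
Proof.
move=> pAB; have sAB := perm_size pAB.
rewrite /mism size_cat iotaD count_cat add0n; congr (_ + _).
  apply: eq_in_count => i; rewrite mem_iota add0n /= => ltiA.
  by rewrite /aligned !nth_cat -sAB ltiA !takel_cat -?sAB // ltnW.
rewrite -{1}(addn0 (size A)) iotaDl count_map; apply: eq_count => i /=.
rewrite /aligned !nth_cat -sAB ltnNge leq_addr /= addKn.
rewrite !take_cat -sAB ltnNge leq_addr /= addKn.
congr (~~ (_ && _)); rewrite -[RHS](perm_cat2l A).
have /permPr -> // : perm_eq (B ++ take i D) (A ++ take i D).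
by rewrite perm_cat2r perm_sym.
Qed.

End Mismatches.

(** * The k-bonacci morphism and its fixed point *)

Section Morphism.
Local Open Scope nat_scope.
Variable k : nat.
Hypothesis k_ge2 : 1 < k.

Definition morph (w : seq nat) :=
  flatten [seq (if a.+1 < k then [:: 0; a.+1] else [:: 0]) | a <- w].

Definition img n w := iter n morph w.

Definition sz n a := size (img n [:: a]).

Definition std n := img n [:: 0].

Definition len n := size (std n).

Lemma morph_cat A B : morph (A ++ B) = morph A ++ morph B.
Proof. by rewrite /morph map_cat flatten_cat. Qed.

Lemma img_cat n A B : img n (A ++ B) = img n A ++ img n B.
Proof. by elim: n => //= n ->; rewrite morph_cat. Qed.

Lemma imgD m n w : img (m + n) w = img m (img n w).
Proof. exact: iterD. Qed.

Lemma imgSr n w : img n.+1 w = img n (morph w).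
Proof. exact: iterSr. Qed.

Lemma img_nil n : img n [::] = [::].
Proof. by elim: n => //= n ->. Qed.

Lemma img_cons n a w : img n (a :: w) = img n [:: a] ++ img n w.
Proof. by rewrite -cat1s img_cat. Qed.

Lemma img_perm n A B : perm_eq A B -> perm_eq (img n A) (img n B).
Proof.
by elim: n => //= n IH /IH h; apply: perm_flatten; apply: perm_map.
Qed.

Lemma size_img_perm n A B : perm_eq A B -> size (img n A) = size (img n B).
Proof. by move=> /(img_perm n)/perm_size. Qed.

(** * Lengths of the images of letters *)

Lemma szS n a : sz n.+1 a = len n + (if a.+1 < k then sz n a.+1 else 0).
Proof.
rewrite /sz imgSr /morph /= cats0; case: ifP => // _; last by rewrite addn0.
by rewrite img_cons size_cat.
Qed.

Lemma sz0 n : sz n 0 = len n. Proof. by []. Qed.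

Lemma sz_decr n a : sz n a.+1 <= sz n a.
Proof.
elim: n a => // n IH a; rewrite !szS leq_add2l; case: ifP => // lt.
by rewrite (ltnW lt).
Qed.

Lemma sz_anti n a b : a <= b -> sz n b <= sz n a.
Proof.
move=> /subnKC <-; elim: (b - a) => [|d IH]; first by rewrite addn0.
by rewrite addnS (leq_trans (sz_decr _ _)).
Qed.

Lemma sz_le n a : sz n a <= len n.
Proof. exact: sz_anti. Qed.

Lemma lenS n : len n.+1 = len n + sz n 1.
Proof. by rewrite -sz0 szS k_ge2. Qed.

Lemma len_gt0 n : 0 < len n.
Proof. by elim: n => // n IH; rewrite lenS ltn_addr. Qed.

Lemma len_le_sz n : len n <= sz n.+1 1.
Proof. by rewrite szS leq_addr. Qed.

(** For n > 0 the image of any letter starts with [std n.-1], and lengths at most double from one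
    level to the next. *)
Lemma len_le2sz n a : len n <= 2 * sz n a.
Proof.
case: n => [|n]; first by [].
rewrite szS lenS mul2n -addnn leq_add // ?leq_addr //.
by rewrite (leq_trans (sz_le _ _)) ?leq_addr.
Qed.

Lemma sz_gt0 n a : 0 < sz n a.
Proof. by move: (len_le2sz n a) (len_gt0 n); lia. Qed.

Lemma len_le_double n : len n.+1 <= 2 * len n.
Proof. by rewrite lenS mul2n -addnn leq_add2l sz_le. Qed.

Lemma len_leD n d : len (n + d) <= 2 ^ d * len n.
Proof.
elim: d => [|d IH]; first by rewrite addn0 mul1n.
rewrite addnS (leq_trans (len_le_double _)) // expnS -mulnA.
by rewrite leq_mul2l.
Qed.

Lemma len_ltS n : len n < len n.+1.
Proof. by rewrite lenS -addn1 leq_add2l sz_gt0. Qed.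

Lemma len_mono m n : m <= n -> len m <= len n.
Proof.
move=> /subnKC <-; elim: (n - m) => [|d IH]; first by rewrite addn0.
by rewrite addnS (leq_trans IH) // ltnW ?len_ltS.
Qed.

Lemma len_gtn n : n < len n.
Proof. by elim: n => // n IH; apply: leq_ltn_trans IH _; exact: len_ltS. Qed.

Lemma len_gap n : len n.+1 + len n <= len n.+2.
Proof. by rewrite (lenS n.+1) leq_add2l len_le_sz. Qed.

(* [pal d] is the word w_(d-1) ... w_0, which is the common prefix of the words
   phi^d (a), a < k - d. *)
Fixpoint pal d := if d is d'.+1 then morph (pal d') ++ [:: 0] else [::].

Lemma img_letter d y : y + d < k -> img d [:: y] = pal d ++ [:: y + d].
Proof.
elim: d => [|d IH]; first by rewrite addn0.
rewrite addnS => lt; rewrite /img iterS -/(img d _) IH; last exact: ltnW.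
by rewrite morph_cat -catA; congr (_ ++ _); rewrite /morph /= lt.
Qed.

Lemma img_last_letter d c : 0 < d -> d + c = k -> img d [:: c] = pal d.
Proof.
case: d => // d _ dck; rewrite /img iterS -/(img d _) img_letter; last by lia.
rewrite morph_cat /=; congr (_ ++ _); rewrite /morph /=.
by case: ifP => //; lia.
Qed.

Lemma pal_letters d z : z \in pal d -> z < d.
Proof.
elim: d z => // d IH z /=; rewrite mem_cat inE => /orP[|/eqP->//].
move=> /flattenP[s /mapP[b /IH bd ->]].
case: ifP => _; rewrite !inE; last by move=> /eqP ->.
by case/orP => /eqP ->.
Qed.

(** This is the image under phi^m of phi^k (0) = phi^k (1) 0. *)
Lemma std_kD m : std (m + k) = img (m + k) [:: 1] ++ std m.
Proof.
rewrite /std imgD (imgD m k) -img_cat; congr (img m _).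
have [k' Ek] : exists k', k = k'.+1 by exists k.-1; lia.
have h0 : img k [:: 0] = pal k.
  by apply: img_last_letter; rewrite ?addn0 //; lia.
have h1 : img k [:: 1] = morph (pal k').
  have -> : img k [:: 1] = morph (img k' [:: 1]) by rewrite {1}Ek.
  by congr morph; apply: img_last_letter; lia.
have h2 : pal k = morph (pal k') ++ [:: 0] by rewrite {1}Ek.
by rewrite h0 h1 h2.
Qed.

Lemma stdS n : std n.+1 = std n ++ img n [:: 1].
Proof.
have s0 : morph [:: 0] = [:: 0; 1] by rewrite /morph /= k_ge2.
by rewrite /std imgSr s0 img_cons.
Qed.

Lemma std_double m : std (m + k).+1 ++ std m = std (m + k) ++ std (m + k).
Proof. by rewrite stdS -catA -std_kD. Qed.

(** By [std_kD] the image of 1 lacks a copy of [std (n - k)], at least the fraction 2^-k of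
    [std n]. *)
Lemma sz1_contract n : k <= n -> 2 ^ k * sz n 1 <= (2 ^ k).-1 * len n.
Proof.
move=> /subnK <-; set m := n - k.
have e : len (m + k) = sz (m + k) 1 + len m by rewrite /len std_kD size_cat.
have h := len_leD m k; have p : 0 < 2 ^ k by rewrite expn_gt0.
by move: e h p; nia.
Qed.

(** * Misaligned positions created by exchanging two letters *)

Definition swap n a b := mism (img n [:: a; b]) (img n [:: b; a]).

Lemma perm_swap2 (a b : nat) w : perm_eq (a :: b :: w) (b :: a :: w).
Proof. by apply/permP => P /=; rewrite addnCA. Qed.

Lemma swapC n a b : swap n a b = swap n b a.
Proof. by apply: mism_sym; apply: size_img_perm; apply: perm_swap2. Qed.

Lemma swap_refl n a : swap n a a = 0. Proof. exact: mism_refl. Qed.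

Lemma swap_le n a b : swap n a b <= sz n a + sz n b.
Proof. by apply: leq_trans (mism_le_size _ _) _; rewrite img_cons size_cat. Qed.

(** The letter [c] passes through [Y] by successive exchanges of neighbours, whose costs add up by
    [mism_trans]. *)
Lemma mism_move n c Y :
  mism (img n (c :: Y)) (img n (Y ++ [:: c])) <= \sum_(z <- Y) swap n c z.
Proof.
elim: Y => [|z Y IH]; first by rewrite mism_refl big_nil.
rewrite big_cons; have pz := perm_swap2 c z Y.
apply: leq_trans (mism_trans (B := img n (z :: c :: Y)) _ _) _.
  by apply: size_img_perm.
apply: leq_add.
  have e a b : img n (a :: b :: Y) = img n [:: a; b] ++ img n Y.
    by rewrite -img_cat.
  rewrite !e.
  by rewrite mism_cat ?mism_refl ?addn0 // img_perm // perm_swap2.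
rewrite cat_cons (img_cons n z (c :: Y)) (img_cons n z (Y ++ _)).
by rewrite mism_cat ?mism_refl // img_perm.
Qed.

Lemma swap_step n d y : 0 < d -> y + d < k ->
  swap (n + d) y (k - d) <= \sum_(z <- pal d) swap n (y + d) z.
Proof.
move=> d0 ydk; rewrite /swap !imgD !(img_cons d _ [:: _]).
rewrite !(img_letter ydk) (img_last_letter (c := k - d)) //; last by lia.
rewrite -catA (img_cat n (pal d) ([:: y + d] ++ pal d)).
rewrite (img_cat n (pal d) (pal d ++ _)) mism_cat // mism_refl add0n.
exact: mism_move.
Qed.

Lemma size_img n w : size (img n w) = \sum_(a <- w) sz n a.
Proof.
elim: w => [|a w IH]; first by rewrite img_nil big_nil.
by rewrite img_cons size_cat IH big_cons.
Qed.

(** The constant C of the overview is the fraction A / B, kept in naturals. *)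
Definition swap_bound A B n := forall y c, y < c -> c < k ->
  B * (len n * swap n y c) <= A * (sz n y * sz n c).

(** The hypothesis, summed over the letters of [pal d], gives a bound proportional to s x / |w_n|.
    The gain comes from the letters d and y + d being positive: their images have length at most (1
    - 2^-k) |w_n|. *)
Lemma swap_contract A B n y d : k <= n -> swap_bound A B n ->
  0 < d -> y + d < k -> y < k - d ->
  2 ^ k * B * (len (n + d) * swap (n + d) y (k - d)) <=
    (2 ^ k).-1 * A * (sz (n + d) y * sz (n + d) (k - d)).
Proof.
move=> kn hB d0 ydk ykd.
set s := sz n (y + d); set x := size (img n (pal d)).
have Ec : sz (n + d) (k - d) = x.
  by rewrite /sz imgD (img_last_letter (c := k - d)) //; lia.
have Ey : sz (n + d) y = x + s.
  by rewrite /sz imgD img_letter // img_cat size_cat.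
have Et : len (n + d) = x + sz n d.
  by rewrite -sz0 /sz imgD (img_letter (y := 0)) ?img_cat ?size_cat //; lia.
have hs : B * (len n * swap (n + d) y (k - d)) <= A * (s * x).
  apply: leq_trans (_ : B * (len n * \sum_(z <- pal d) swap n (y + d) z) <= _).
    by rewrite !leq_mul // swap_step.
  rewrite /x size_img !big_distrr /= big_seq [leqRHS]big_seq.
  apply: leq_sum => z /pal_letters zd; rewrite swapC (mulnC s).
  by apply: hB; lia.
have hd : 2 ^ k * sz n d <= (2 ^ k).-1 * len n.
  by apply: leq_trans (sz1_contract kn); rewrite leq_mul2l sz_anti // orbT.
have hsd : 2 ^ k * s <= (2 ^ k).-1 * len n.
  by apply: leq_trans hd; rewrite leq_mul2l sz_anti ?orbT // leq_addl.
(* Termwise comparison of s (x + [sz n d]) with |w_n| (x + s). *)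
have st : 2 ^ k * (s * len (n + d)) <= (2 ^ k).-1 * len n * sz (n + d) y.
  rewrite Et Ey !mulnDr; apply: leq_add.
    by rewrite mulnA leq_mul2r hsd orbT.
  by rewrite mulnCA mulnC leq_mul2r hd orbT.
rewrite Ec -(leq_pmul2l (len_gt0 n)).
have h1 : len n * (2 ^ k * B * (len (n + d) * swap (n + d) y (k - d))) =
   2 ^ k * len (n + d) * (B * (len n * swap (n + d) y (k - d))) by lia.
rewrite h1; apply: leq_trans (leq_mul (leqnn _) hs) _.
have h2 : 2 ^ k * len (n + d) * (A * (s * x)) =
  A * x * (2 ^ k * (s * len (n + d))) by lia.
rewrite h2; apply: leq_trans (leq_mul (leqnn _) st) _.
by apply: eq_leq; lia.
Qed.

(** The initial 4 comes from [swap_le] and two uses of [len_le2sz]. *)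
Lemma swap_bound_iter i : exists N, forall n, N <= n ->
  swap_bound (4 * (2 ^ k).-1 ^ i) ((2 ^ k) ^ i) n.
Proof.
elim: i => [|i [N IH]].
  exists 0 => n _ y c _ _; rewrite !expn0 muln1 mul1n.
  have := swap_le n y c; move: (len_le2sz n y) (len_le2sz n c) (len_le2sz n y).
  set a := sz n y; set b := sz n c; set T := len n; set h := swap n y c.
  move=> h1 h2 _ h3; apply: leq_trans (leq_mul (leqnn T) h3) _.
  by rewrite mulnDr; nia.
(* One k pays for the descent by d = k - c, the other for the condition k <= m of
   [swap_contract]. *)
exists (N + k + k) => n le y c yc ck.
have d0 : 0 < k - c by lia.
have cE : k - (k - c) = c by lia.
have [m mE] : exists m, n = m + (k - c) by exists (n - (k - c)); lia.
have km : k <= m by lia.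
have Nm : N <= m by lia.
have := @swap_contract _ _ m y (k - c) km (IH m Nm) d0.
rewrite cE -mE => /(_ ltac:(lia) yc); rewrite !expnS.
by rewrite (mulnCA 4).
Qed.

Lemma pow_beats D g : exists i, g * D ^ i <= D.+1 ^ i.
Proof.
have h i : i.+1 * D ^ i <= D.+1 ^ i.+1.
  elim: i => // i IH; rewrite mulSn (expnS D.+1) (mulSn D) leq_add //.
    by rewrite leq_exp2r.
  by rewrite expnS mulnCA leq_mul2l IH orbT.
exists (g * D).+1; apply: leq_trans (h _).
by rewrite expnS mulnA leq_mul2r leqnSn orbT.
Qed.

(** For y = 0 the factor [len n] cancels from [swap_bound], and A / B can be made at most 1 / g. *)
Lemma swap_small g : exists N, forall n, N <= n -> forall z, z < k ->
  g * swap n 0 z <= sz n z.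
Proof.
have [i hi] := pow_beats (2 ^ k).-1 (g * 4).
have [N hN] := swap_bound_iter i; exists N => n Nn [|z] zk.
  by rewrite swap_refl muln0.
have p : 0 < 2 ^ k by rewrite expn_gt0.
have := hN n Nn 0 z.+1 isT zk; rewrite (ltn_predK p) in hi *.
rewrite sz0; set T := len n; set h := swap _ _ _; set b := sz _ _.
move: hi; set X := (2 ^ k) ^ i; set Y := _ ^ i => hi hh.
have T0 : 0 < T := len_gt0 n.
have X0 : 0 < X by rewrite expn_gt0 p.
have h1 : X * h <= 4 * Y * b by rewrite -(leq_pmul2l T0); nia.
rewrite -(leq_pmul2l X0).
have h2 := leq_mul (leqnn g) h1.
have h3 := leq_mul hi (leqnn b).
by nia.
Qed.

Lemma morph_head w : nth 0 (morph w) 0 = 0.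
Proof. by case: w => //= a w; rewrite /morph /=; case: ifP. Qed.

(** * Factors of the fixed point and their images *)

Variable U : nat -> nat.
Hypothesis U_lt : forall i, U i < k.
Hypothesis U_std : forall n, map U (iota 0 (len n)) = std n.

Definition seg p l := map U (iota p l).

Lemma size_seg p l : size (seg p l) = l.
Proof. by rewrite size_map size_iota. Qed.

Lemma segD p l m : seg p (l + m) = seg p l ++ seg (p + l) m.
Proof. by rewrite /seg iotaD map_cat. Qed.

Lemma nth_seg p l i : i < l -> nth 0 (seg p l) i = U (p + i).
Proof. by move=> il; rewrite (nth_map 0) ?size_iota // nth_iota. Qed.

Lemma take_seg p l i : i <= l -> take i (seg p l) = seg p i.
Proof. by move=> /subnKC <-; rewrite segD take_size_cat ?size_seg. Qed.

(* The position where the image under phi^n of the i-th letter of U starts. *)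
Definition pos n i := size (img n (seg 0 i)).

Lemma seg_pos n i : seg 0 (pos n i) = img n (seg 0 i).
Proof.
have [r Er] : exists r, std i = seg 0 i ++ r.
  by exists (seg i (len i - i)); rewrite -U_std -segD subnKC // ltnW ?len_gtn.
have E : seg 0 (len (n + i)) = img n (seg 0 i) ++ img n r.
  by rewrite /seg U_std /std imgD -/(std i) Er img_cat.
have le : pos n i <= len (n + i).
  by rewrite -(size_seg 0 (len (n + i))) E size_cat leq_addr.
by rewrite -(take_seg _ le) E take_size_cat.
Qed.

Lemma posD n i l : pos n (i + l) = pos n i + size (img n (seg i l)).
Proof. by rewrite /pos segD img_cat size_cat. Qed.

Lemma seg_img n i l : seg (pos n i) (size (img n (seg i l))) = img n (seg i l).
Proof.
have := seg_pos n (i + l).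
rewrite posD !segD img_cat seg_pos add0n => /eqP.
by rewrite eqseq_cat // eqxx /= => /eqP.
Qed.

Lemma posS n i : pos n i.+1 = pos n i + sz n (U i).
Proof. by rewrite -addn1 posD. Qed.

Lemma pos0 n : pos n 0 = 0.
Proof. by rewrite /pos /seg /= img_nil. Qed.

Lemma pos_len n m : pos n (len m) = len (n + m).
Proof. by rewrite /pos /seg U_std /len /std imgD. Qed.

Lemma pos_pos n m i : pos n (pos m i) = pos (n + m) i.
Proof. by rewrite {1}/pos seg_pos -imgD. Qed.

Lemma pos_leD n i l : pos n (i + l) <= pos n i + l * len n.
Proof.
elim: l => [|l IH]; first by rewrite !addn0.
by rewrite addnS posS mulSn addnCA addnC leq_add // sz_le.
Qed.

Lemma pos_geD n i l : 2 * pos n i + l * len n <= 2 * pos n (i + l).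
Proof.
elim: l => [|l IH]; first by rewrite !addn0.
by rewrite addnS posS mulSn mulnDr addnCA addnC leq_add // len_le2sz.
Qed.

Lemma pos_ltS n i : pos n i < pos n i.+1.
Proof. by rewrite posS -addn1 leq_add2l sz_gt0. Qed.

Lemma pos_mono n i j : i <= j -> pos n i <= pos n j.
Proof. by move=> /subnKC <-; rewrite posD leq_addr. Qed.

Lemma pos_lt n i j : i < j -> pos n i < pos n j.
Proof. by move=> ij; apply: leq_trans (pos_ltS n i) (pos_mono n ij). Qed.

Lemma pos_ge n i : i <= pos n i.
Proof. by elim: i => // i IH; apply: leq_ltn_trans IH (pos_ltS n i). Qed.

Lemma pos_inv n p : exists i, pos n i <= p < pos n i.+1.
Proof.
have ex : exists i, p < pos n i by exists p.+1; apply: pos_ge.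
case: (ex_minnP ex) => [[|i]]; first by rewrite pos0.
move=> lt hmin; exists i; rewrite lt andbT leqNgt; apply/negP => /hmin.
by rewrite ltnn.
Qed.

Lemma U0 : U 0 = 0.
Proof. by have [] := U_std 0. Qed.

Lemma seg_block n i : seg (pos n i) (sz n (U i)) = img n [:: U i].
Proof. exact: (seg_img n i 1). Qed.

Lemma U_pos n i : 0 < n -> U (pos n i) = 0.
Proof.
case: n => // n _; have := nth_seg (pos n.+1 i) (sz_gt0 n.+1 (U i)).
by rewrite addn0 seg_block => <-; rewrite /img iterS morph_head.
Qed.

(** [U] is cut into blocks of length at most two, each starting with 0. *)
Lemma U_zero i : U i = 0 \/ U i.+1 = 0.
Proof.
have [j /andP[le lt]] := pos_inv 1 i.
have := le; rewrite leq_eqVlt => /orP[/eqP<-|lt'].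
  by left; rewrite U_pos.
right; have -> : i.+1 = pos 1 j.+1.
  apply/eqP; rewrite eqn_leq lt /= posS.
  have : sz 1 (U j) <= 2 by rewrite (leq_trans (sz_le _ _)) // lenS.
  by lia.
by rewrite U_pos.
Qed.

(** * Positions aligned with the shifted word *)

Definition good M i :=
  (U i == U (len M + i)) && perm_eq (seg 0 i) (seg (len M) i).

(** Abelian equivalence of the prefixes puts the images of the two equal letters exactly
    [len (n + M)] apart, for every n at once. *)
Lemma good_eq M n i p : good M i -> pos n i <= p < pos n i.+1 ->
  U (p + len (n + M)) = U p.
Proof.
move=> /andP[/eqP eU pe] /andP[le lt].
have e : pos n (len M + i) = len (n + M) + pos n i.
  rewrite posD pos_len; congr (_ + _).
  by apply: size_img_perm; rewrite perm_sym.
have l : p - pos n i < sz n (U i) by rewrite ltn_subLR // -posS.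
have := nth_seg (pos n i) l; rewrite seg_block (subnKC le) => <-.
have := nth_seg (pos n (len M + i)) l; rewrite eU seg_block => ->.
by rewrite e -addnA subnKC // addnC.
Qed.

Lemma seg_zero q : U q = 0 -> seg 0 q ++ [:: 0] = 0 :: seg 1 q.
Proof.
move=> Uq; have := segD 0 q 1; rewrite add0n [seg q 1]/seg /= Uq => <-.
by rewrite addn1 /seg /= U0.
Qed.

Lemma perm_seg_zero q : U q = 0 -> perm_eq (seg 0 q) (seg 1 q).
Proof.
move=> /seg_zero E; rewrite -(perm_cat2r [:: 0]) E.
by rewrite perm_sym perm_catC.
Qed.

Lemma pos_zero n q : U q = 0 -> pos n q.+1 = len n + pos n q.
Proof. by move=> Uq; rewrite posS Uq addnC. Qed.

(** Deleting the initial 0 of [U] deletes [len M] letters of the image, so this shift comes from the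
    shift by one at level 0. *)
Lemma seg_shift M q : U q = 0 ->
  seg (len M) (pos M q) = img M (seg 1 q).
Proof.
move=> Uq; rewrite -(seg_img M 1 q) -(size_img_perm _ (perm_seg_zero Uq)).
by rewrite posS U0 pos0.
Qed.

(** All explicit aligned positions used for the zones arise this way. *)
Lemma good_pos M q : 0 < M -> U q = 0 -> good M (pos M q).
Proof.
move=> M0 Uq; rewrite /good -pos_zero // !U_pos // eqxx /=.
by rewrite seg_shift // seg_pos img_perm // perm_seg_zero.
Qed.

Definition bad M B := count (fun i => ~~ good M i) (iota 0 B).

Lemma bad_mism M B : bad M B = mism (seg 0 B) (seg (len M) B).
Proof.
rewrite /bad /mism size_seg; apply: eq_in_count => i.
rewrite mem_iota add0n /= => iB.
by rewrite /aligned !nth_seg // !take_seg // ltnW.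
Qed.

(** The words compared are images of 0 Y and Y 0; moving 0 past a letter costs at most 1 / g of the
    length of its image. *)
Lemma bad_pos M g q : (forall z, z < k -> g * swap M 0 z <= sz M z) ->
  U q = 0 -> g * bad M (pos M q) <= pos M q.
Proof.
move=> hg Uq; rewrite bad_mism seg_pos seg_shift //.
case: q Uq => [|q] Uq; first by rewrite mism_refl muln0.
have E : seg 0 q.+1 = 0 :: seg 1 q by rewrite /seg /= U0.
have E' : seg 1 q.+1 = seg 1 q ++ [:: 0].
  by rewrite -(addn1 q) segD add1n [seg q.+1 1]/seg /= Uq.
rewrite E E' /pos E; apply: leq_trans (leq_mul (leqnn _) (mism_move _ _ _)) _.
rewrite img_cons size_cat (leq_trans _ (leq_addl _ _)) // size_img.
rewrite big_distrr /=.
by rewrite /seg !big_map; apply: leq_sum => i _; apply: hg.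
Qed.

Lemma bad_mono M B B' : B <= B' -> bad M B <= bad M B'.
Proof. by move=> /subnKC <-; rewrite /bad iotaD count_cat leq_addr. Qed.

Lemma bad_density g : exists2 M, 0 < M & exists C, forall B,
  g * bad M B <= B + C.
Proof.
have [N hN] := swap_small g; exists N.+1 => //; exists (2 * len N.+1) => B.
have {hN} hN := hN N.+1 (leqnSn N).
set M := N.+1 in hN *.
have [i /andP[le lt]] := pos_inv M B.
(* [bad_pos] needs a 0 at q, so B is rounded up to such a block boundary; the constant C absorbs the
   excess. *)
have [q [Uq iq qi]] : exists q, [/\ U q = 0, i < q & q <= i + 2].
  by case: (U_zero i.+1) => Uq; [exists i.+1 | exists i.+2]; split => //; lia.
have Bq : B <= pos M q by apply: ltnW; apply: leq_trans lt (pos_mono _ iq).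
have qB : pos M q <= B + 2 * len M.
  apply: leq_trans (pos_mono _ qi) _; apply: leq_trans (pos_leD _ _ _) _.
  by rewrite leq_add2r.
apply: leq_trans (_ : g * bad M (pos M q) <= _).
  by rewrite leq_mul2l bad_mono ?orbT.
by apply: leq_trans (bad_pos hN Uq) qB.
Qed.

Lemma U_len a : 0 < a -> U (len a) = 0.
Proof. by move=> a0; rewrite -(addn0 a) -pos_len; apply: U_pos. Qed.

(** The word w_m recurs right after w_(m+1), because phi (1) begins with 0 and so phi^(m+1) (1)
    begins with w_m. *)
Lemma seg_len m l : l <= len m -> seg (len m.+1) l = seg 0 l.
Proof.
move=> lm; suff E : seg (len m.+1) (len m) = std m.
  by rewrite -(take_seg _ lm) E -U_std take_seg.
have [r Er] : exists r, img m.+1 [:: 1] = std m ++ r.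
  rewrite imgSr /morph /= cats0; case: ifP => _; last first.
    by exists [::]; rewrite cats0.
  by exists (img m [:: 2]); rewrite img_cons.
have := U_std m.+2; rewrite -/(seg 0 _) stdS Er catA (lenS m.+1).
have -> : sz m.+1 1 = len m + size r by rewrite /sz Er size_cat.
rewrite addnA !segD add0n => /eqP; rewrite !eqseq_cat ?size_cat ?size_seg //.
by move=> /andP[/andP[_ /eqP]].
Qed.

Lemma pos_zone M m a : a < m ->
  pos M (len m.+1 + len a) = len (M + m.+1) + len (M + a).
Proof.
move=> am; rewrite posD pos_len seg_len; last by apply: len_mono; apply: ltnW.
by rewrite /seg U_std /std -imgD.
Qed.

(** * Values of words at x = 1 / beta and non-vanishing *)

Section Evaluation.
Variables (F : fieldType) (x : F).
Local Open Scope ring_scope.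

(** Horner form of the sum of w_i x^i; p_m in the overview is [eval (std m)]. *)
Definition eval (w : seq nat) : F := foldr (fun a r => a%:R + x * r) 0 w.

Lemma eval_cat A B : eval (A ++ B) = eval A + x ^+ size A * eval B.
Proof.
elim: A => [|a A IH]; first by rewrite expr0 mul1r add0r.
by rewrite /= IH mulrDr addrA exprS mulrA.
Qed.

Lemma eval_seg_diff s p l :
  \sum_(i <- iota p l) ((U (i + s))%:R - (U i)%:R) * x ^+ i =
  x ^+ p * (eval (seg (p + s) l) - eval (seg p l)).
Proof.
elim: l p => [|l IH] p; first by rewrite big_nil subrr mulr0.
rewrite big_cons IH /= addSn exprSr -!mulrA mulrC -mulrDr; congr (_ * _).
by rewrite mulrBr opprD addrACA.
Qed.

Hypothesis x_neq0 : x != 0.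
Hypothesis x_not_unity : forall j, (0 < j)%N -> x ^+ j != 1.

Lemma eval_conj_neq N : exists a, [/\ (0 < a)%N, (a <= k)%N &
  eval (img N (seg 1 (len a))) != eval (img N (std a))].
Proof.
set P := fun a =>
  (0 < a)%N && (eval (img N (seg 1 (len a))) != eval (img N (std a))).
case: (boolP (has P (iota 0 k.+1))) => [/hasP[a]|/hasPn hN].
  by rewrite mem_iota add0n ltnS => /= ak /andP[a0 ne]; exists a.
have nz j : 1 - x ^+ len j != 0 by rewrite subr_eq0 eq_sym x_not_unity ?len_gt0.
(* If all differences vanish, eval (std m) = v (1 - x ^ len m) for
   N <= m <= N + k, and [std_double] carries this identity down to m = 0. *)
set v := eval (std N) / (1 - x ^+ len N).
have base a : (a <= k)%N -> eval (std (N + a)) = v * (1 - x ^+ len (N + a)).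
  case: a => [|a] ak; first by rewrite addn0 /v mulfVK.
  have /hN : a.+1 \in iota 0 k.+1 by rewrite mem_iota.
  rewrite /P ltn0Sn andTb negbK => /eqP e.
  (* The two words agree since [U] has a 0 at [len a.+1]; evaluating both factorizations gives the
     value of w_(N+a+1). *)
  have : eval (img N (std a.+1 ++ [:: 0%N])) =
      eval (img N (0%N :: seg 1 (len a.+1))).
    by rewrite -(seg_zero (U_len (ltn0Sn a))) -U_std.
  rewrite img_cat (img_cons _ 0 (seg 1 _)) !eval_cat e /std -imgD.
  rewrite -!/(std _) -!/(len _) => h; apply: (mulIf (nz N)).
  rewrite mulrAC /v mulfVK // !mulrBr !mulr1 (mulrC _ (x ^+ len N)).
  by apply/eqP; rewrite subr_eq addrAC -h mulrC addrK.
have down d : (d <= N)%N -> forall a, (a <= k)%N ->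
    eval (std (N - d + a)) = v * (1 - x ^+ len (N - d + a)).
  elim: d => [|d IH] dN; first by rewrite subn0.
  have {IH} IH := IH (ltnW dN).
  have eN : (N - d)%N = (N - d.+1).+1 by lia.
  rewrite eN in IH; move: (N - d.+1)%N IH => m IH [|a] ak; last first.
    by rewrite addnS -addSn; apply: IH; apply: ltnW.
  rewrite addn0.
  have h1 := IH k (leqnn k); rewrite addSn in h1.
  have h2 : eval (std (m + k)) = v * (1 - x ^+ len (m + k)).
    have := IH k.-1; rewrite addSn -addnS prednK; last by lia.
    by apply; lia.
  (* Values and lengths in w_(m+k+1) w_m = w_(m+k) w_(m+k) together determine the value of w_m. *)
  have := congr1 eval (std_double m); rewrite !eval_cat h1 h2 -!/(len _).
  have := congr1 size (std_double m); rewrite !size_cat -!/(len _).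
  set T' := len (m + k).+1; set T := len (m + k) => eT h.
  have xT : x ^+ T' != 0 by rewrite expf_neq0.
  apply: (mulfI xT); have : x ^+ T' * x ^+ len m = x ^+ T * x ^+ T.
    by rewrite -!exprD eT.
  move: h; set y := x ^+ T'; set z := x ^+ T; set w := x ^+ len m.
  move=> h e; have -> : y * eval (std m) =
      v * (1 - z) + z * (v * (1 - z)) - v * (1 - y).
    by rewrite -h addrC addKr.
  have -> : y * (v * (1 - w)) = v * (y - y * w) by rewrite mulrCA mulrBr mulr1.
  rewrite e; ring.
(* The word w_0 = 0 has value 0, whereas w_1 = 0 1 has value x. *)
have v0 : v = 0.
  have := down N (leqnn N) 0 (leq0n k).
  rewrite subnn /= mulr0 addr0 => /esym/eqP.
  by rewrite mulf_eq0 (negPf (nz 0)) orbF => /eqP.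
have := down N (leqnn N) 1 (ltnW k_ge2).
rewrite subnn v0 mul0r add0n stdS eval_cat /= !mulr0 !addr0 add0r mulr1 => /eqP.
by rewrite (negPf x_neq0).
Qed.

(** The choice of [a] does not depend on the zone m: after w_(m+1) the word [U] always shows w_a
    and, one letter later, [seg 1 (len a)]. *)
Lemma zone_sum_neq0 M n : (0 < M)%N -> exists a, [/\ (0 < a)%N, (a <= k)%N &
  forall m L, (k < m)%N -> L = len (M + m.+1) ->
  \sum_(i <- iota (pos n L.+1) (pos n (L + len (M + a)) - pos n L.+1))
    ((U (i + len (n + M)))%:R - (U i)%:R) * x ^+ i != 0].
Proof.
move=> M0; have [a [a0 ak ne]] := eval_conj_neq (n + M).
exists a; split=> // m L km EL0.
have am : (a < m)%N by lia.
set N := (n + M)%N in ne *.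
have UL : U (len m.+1) = 0%N by apply: U_len.
have EL : pos n L = pos N (len m.+1) by rewrite EL0 !pos_len addnA.
have EE : pos n (L + len (M + a)) = (pos n L + len (N + a))%N.
  by rewrite EL EL0 -(pos_zone _ am) pos_pos (pos_zone _ am) pos_len.
have gL : good M L by rewrite EL0 -pos_len; apply: good_pos.
have le1 : (pos n L < pos n L.+1)%N := pos_ltS n L.
have le2 : (pos n L.+1 <= pos n (L + len (M + a)))%N.
  by apply: pos_mono; move: (len_gt0 (M + a)); lia.
set f := fun i => ((U (i + len N))%:R - (U i)%:R) * x ^+ i.
(* [L] is aligned, so its image contributes zero and the sum may start at [pos n L]. *)
have -> : \sum_(i <- iota (pos n L.+1)
      (pos n (L + len (M + a)) - pos n L.+1)) f i
    = \sum_(i <- iota (pos n L) (len (N + a))) f i.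
  have -> : (len (N + a) = (pos n L.+1 - pos n L) +
      (pos n (L + len (M + a)) - pos n L.+1))%N by lia.
  rewrite iotaD big_cat /= subnKC; last exact: ltnW.
  rewrite [X in _ = X + _]big_seq [X in _ = X + _]big1 ?add0r // => i.
  rewrite mem_iota subnKC ?(ltnW le1) // => hi.
  by rewrite /f (good_eq (n := n) gL) // subrr mul0r.
rewrite /f eval_seg_diff mulf_neq0 ?expf_neq0 //.
rewrite {f} EL.
have <- : size (img N (std a)) = len (N + a) by rewrite /std -imgD.
have Ea : seg (len m.+1) (len a) = std a.
  by rewrite seg_len; [exact: U_std | apply: len_mono; apply: ltnW].
rewrite addnC -pos_zero //.
have Ea' : seg (len m.+1).+1 (len a) = seg 1 (len a).
  have h : ((len a).+1 <= len m)%N.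
    by apply: leq_trans (len_mono am); apply: len_ltS.
  have := seg_len h; rewrite -(add1n (len a)) !segD => /eqP.
  by rewrite eqseq_cat // addn1 => /andP[_ /eqP].
have sE : size (img N (std a)) = size (img N (seg 1 (len a))).
  rewrite -U_std; apply: size_img_perm; exact: perm_seg_zero (U_len a0).
have -> : seg (pos N (len m.+1).+1) (size (img N (std a))) =
    img N (seg 1 (len a)).
  by rewrite sE -Ea' seg_img.
have -> : seg (pos N (len m.+1)) (size (img N (std a))) = img N (std a).
  by rewrite -Ea seg_img.
by rewrite subr_eq0.
Qed.

End Evaluation.

End Morphism.

(** * Runs of positions with movable cuts *)

Section Runs.
Local Open Scope nat_scope.

Lemma next_true (P : pred nat) : (forall p, exists2 q, p <= q & P q) ->
  exists f, forall p, [/\ p <= f p, P (f p) & forall i, p <= i < f p -> ~~ P i].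
Proof.
move=> hP; suff /choice[f hf] : forall p, exists q,
    [/\ p <= q, P q & forall i, p <= i < q -> ~~ P i] by exists f.
move=> p; have ex : exists q, (p <= q) && P q.
  by have [q pq Pq] := hP p; exists q; rewrite pq.
case: (ex_minnP ex) => q /andP[pq Pq] qmin; exists q; split=> // i /andP[pi iq].
by apply/negP => Pi; have := qmin i; rewrite pi Pi leqNgt iq => /(_ isT).
Qed.

Lemma runs_exist (K : pred nat) : ~~ K 0 ->
  (forall p, exists2 q, p <= q & K q) ->
  (forall p, exists2 q, p <= q & ~~ K q) ->
  exists a b : nat -> nat, [/\ 0 < a 0, forall i, i < a 0 -> ~~ K i,
    forall j, a j < b j /\ b j < a j.+1,
    forall j i, a j <= i < b j -> K i &
    forall j i, b j <= i < a j.+1 -> ~~ K i].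
Proof.
move=> K0 /next_true[f hf] /(@next_true (predC K))[h hh].
pose a j := iter j (f \o h) (f 0); exists a, (h \o a).
have Ka j : K (a j).
  by case: j => [|j]; [have [] := hf 0 | have [] := hf (h (a j))].
have hlt p : K p -> p < h p.
  move=> Kp; have [le nK _] := hh p; rewrite ltn_neqAle le andbT.
  by apply/eqP => e; rewrite /= -e Kp in nK.
have flt p : ~~ K p -> p < f p.
  move=> Kp; have [le nK _] := hf p; rewrite ltn_neqAle le andbT.
  by apply/eqP => e; rewrite -e (negPf Kp) in nK.
split=> [|i ia|j|j i|j i]; first exact: flt.
- by have [_ _ ->] := hf 0.
- split; first exact: hlt.
  by apply: flt; have [] := hh (a j).
- by have [_ _ h3] := hh (a j) => /h3; rewrite negbK.
- by have [_ _ h3] := hf (h (a j)) => /h3.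
Qed.

Section Frame.
(** In the application [gd] is alignment at level M, zone l starts at [L l], its admissible cuts are
    [L l + e a], and bad positions have density at most 1 / g. *)
Variables (gd : pred nat) (L e : nat -> nat) (k g C : nat).
Let W := (e k).+1.
Hypothesis k_gt0 : 0 < k.
Hypothesis gd0 : gd 0.
Hypothesis gdL : forall l, gd (L l).
Hypothesis gdE : forall l a, 0 < a -> a <= k -> gd (L l + e a).
Hypothesis e1_ge2 : 1 < e 1.
Hypothesis e_mono : {homo e : i j / i <= j}.
Hypothesis L_gap : forall l, L l + W + 2 + g * W <= L l.+1.
Hypothesis bad_count :
  forall B, g * count (fun i => ~~ gd i) (iota 0 B) <= B + C.

(* Runs are built once with every zone cut at L l + e 1, and this cut is moved
   to L l + e (c l) afterwards, so that the number of the run in which a zone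
   starts does not depend on c.  The residue class g + 1 modulo g + 2 is only
   there to bound the gaps between runs. *)
Let in_zone i := has (fun l => L l < i <= L l + W) (iota 0 i).
Let full :=
  [predU [pred i | ~~ gd i] & [predU [pred i | i %% g.+2 == g.+1] & in_zone]].
Let cut i := has (fun l => (i == L l) || (i == L l + e 1)) (iota 0 i.+1).
Let K i := full i && ~~ cut i.

Lemma L_sep l l' : l < l' -> L l + W + 2 <= L l'.
Proof.
move=> /subnKC <-; elim: (l' - l.+1) => [|d IH].
  by rewrite addn0; move: (L_gap l); lia.
by rewrite (addnS l.+1 d); move: (L_gap (l.+1 + d)) IH; lia.
Qed.

Lemma L_eq l l' d d' : L l + d = L l' + d' -> d < W + 2 -> d' < W + 2 -> l = l'.
Proof.
by case: (ltngtP l l') => // /L_sep; lia.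
Qed.

Lemma L_growth l : l * (g * W) + l <= L l.
Proof.
elim: l => // l IH; move: (L_gap l); rewrite mulSn; lia.
Qed.

Lemma e_1k a : 0 < a -> a <= k -> e 1 <= e a /\ e a < W.
Proof.
by move=> a0 ak; split; [apply: e_mono | rewrite ltnS; apply: e_mono].
Qed.

Lemma in_zoneP i : reflect (exists l, L l < i <= L l + W) (in_zone i).
Proof.
apply: (iffP hasP) => [[l _ h]|[l h]]; exists l => //.
by rewrite mem_iota add0n; move: (L_growth l) h; lia.
Qed.

Lemma cutP i : reflect (exists l, i = L l \/ i = L l + e 1) (cut i).
Proof.
apply: (iffP hasP) => [[l _ /orP[]/eqP h]|[l h]]; try by exists l; auto.
exists l; last by case: h => ->; rewrite eqxx ?orbT.
by rewrite mem_iota add0n; move: (L_growth l) h; lia.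
Qed.

Lemma K_zone l i : L l < i <= L l + W -> i != L l + e 1 -> K i.
Proof.
move=> h ne; apply/andP; split.
  by apply/orP; right; apply/orP; right; apply/in_zoneP; exists l.
apply/negP => /cutP[l' h'].
have [e1 e2] := e_1k (leqnn 1) k_gt0.
have ll : l = l'.
  case: h' => h'.
    by apply: (@L_eq _ _ (i - L l) 0); lia.
  by apply: (@L_eq _ _ (i - L l) (e 1)); lia.
by rewrite -ll in h'; move/eqP: ne; lia.
Qed.

Lemma cut_good i : cut i -> gd i.
Proof. by case/cutP => l [] ->; [apply: gdL | apply: gdE]. Qed.

Lemma not_K_good i : ~~ K i -> gd i.
Proof.
apply: contraR => ngd; apply/andP; split; first by apply/orP; left.
by apply: contra ngd; apply: cut_good.
Qed.

(** The residue class meets every window of length g + 2; if its member is a cut, the next position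
    lies in the zone and is no cut, as 1 < [e 1] < W. *)
Lemma K_syndetic p : exists2 q, p <= q < p + g.+2 + 1 & K q.
Proof.
have [q pq qm] : exists2 q, p <= q < p + g.+2 & q %% g.+2 == g.+1.
  exists (p %/ g.+2 * g.+2 + g.+1); last first.
    by rewrite modnMDl modn_small.
  by have := divn_eq p g.+2; have := ltn_pmod p (ltn0Sn g.+1); lia.
case: (boolP (cut q)) => cq; last first.
  by exists q; [lia | rewrite /K cq andbT; apply/orP; right; apply/orP; left].
exists q.+1; first by lia.
have [e1 e2] := e_1k (leqnn 1) k_gt0.
by case/cutP: cq => l [] ->; apply: (@K_zone l) => //; lia.
Qed.

Lemma count_dummy B : g * count [pred i | i %% g.+2 == g.+1] (iota 0 B) <= B.
Proof.
suff : g.+2 * count [pred i | i %% g.+2 == g.+1] (iota 0 B) <= B.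
  by apply: leq_trans; rewrite leq_mul2r; apply/orP; right; lia.
have -> : count [pred i | i %% g.+2 == g.+1] (iota 0 B) = B %/ g.+2.
  elim: B => [|B IH]; first by rewrite div0n.
  rewrite -{1}(addn1 B) iotaD count_cat IH /= add0n addn0.
  rewrite divnS // addnC; congr (nat_of_bool _ + _).
  rewrite /dvdn -(addn1 B) -modnDml.
  have := ltn_pmod B (ltn0Sn g.+1); move: (B %% g.+2) => m lt.
  have [->|ne] := eqVneq m g.+1; first by rewrite addn1 modnn.
  by rewrite modn_small; lia.
by rewrite mulnC leq_divM.
Qed.

Lemma count_window p w B : count (fun i => p < i <= p + w) (iota 0 B) <= w.
Proof.
have -> : count (fun i => p < i <= p + w) (iota 0 B) =
    size (filter (fun i => p < i <= p + w) (iota 0 B)) by rewrite size_filter.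
rewrite -[leqRHS](size_iota p.+1); apply: uniq_leq_size.
  exact: filter_uniq (iota_uniq _ _).
by move=> i; rewrite mem_filter !mem_iota; lia.
Qed.

(** By [L_growth] at most B / (g W) + 1 zones meet [0, B). *)
Lemma count_zone B : g * count in_zone (iota 0 B) <= B + g * W.
Proof.
case: (posnP g) => [->//|g0].
set J := (B %/ (g * W)).+1.
apply: leq_trans (_ : g * (J * W) <= _); last first.
  by rewrite /J mulnCA mulSn addnC leq_add2r leq_divM.
rewrite leq_mul2l; apply/orP; right.
apply: leq_trans
  (_ : \sum_(l < J) count (fun i => L l < i <= L l + W) (iota 0 B) <= _).
  rewrite -sum1_count.
  under [leqRHS]eq_bigr => l _ do rewrite -sum1_count big_mkcond.
  rewrite exchange_big /=.
  rewrite big_mkcond [leqRHS]big_seq big_seq; apply: leq_sum => i.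
  rewrite mem_iota add0n => /= iB.
  case: ifP => // /in_zoneP[l hl].
  have lJ : l < J.
    rewrite /J ltnS leq_divRL ?muln_gt0 ?g0 //.
    by move: (L_growth l); lia.
  by rewrite (bigD1 (Ordinal lJ)) //= hl.
apply: leq_trans (_ : \sum_(l < J) W <= _).
  by apply: leq_sum => l _; apply: count_window.
by rewrite sum_nat_const card_ord.
Qed.

Lemma full_count B : g * count full (iota 0 B) <= 3 * B + (C + g * W).
Proof.
have h : count full (iota 0 B) <= count (fun i => ~~ gd i) (iota 0 B) +
    (count [pred i | i %% g.+2 == g.+1] (iota 0 B) + count in_zone (iota 0 B)).
  rewrite -(count_predUI [pred i | i %% g.+2 == g.+1] in_zone).
  apply: leq_trans (leq_add (leqnn _) (leq_addr _ _)).
  by rewrite -count_predUI leq_addr.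
apply: leq_trans (leq_mul (leqnn g) h) _; rewrite !mulnDr.
by move: (bad_count B) (count_dummy B) (count_zone B); lia.
Qed.

Lemma sum_runs (a b : nat -> nat) (P : pred nat) :
  (forall j, a j < b j /\ b j < a j.+1) ->
  (forall j i, a j <= i < b j -> P i) ->
  forall d, \sum_(j < d.+1) (b j - a j) <= count P (iota 0 (b d)).
Proof.
move=> hab hP; have split_at d : count P (iota 0 (b d)) =
    count P (iota 0 (a d)) + (b d - a d).
  have [ab _] := hab d.
  rewrite -{1}(subnKC (ltnW ab)) iotaD count_cat add0n; congr (_ + _).
  rewrite -[RHS](size_iota (a d)); apply/eqP; rewrite -all_count.
  by apply/allP => i; rewrite mem_iota (subnKC (ltnW ab)) => /hP.
elim=> [|d IH]; rewrite split_at.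
  by rewrite big_ord_recr big_ord0 leq_addl.
rewrite big_ord_recr leq_add2r; apply: leq_trans IH _.
have [_ /ltnW/subnKC <-] := hab d.
by rewrite iotaD count_cat leq_addr.
Qed.

(** Runs are half-open, [a j, b j). The 3 counts one share each for bad positions, the residue class
    and the zones. *)
Definition separated_runs gap C' (a b : nat -> nat) :=
  [/\ [/\ 0 < a 0, a 0 <= gap, forall j, a j < b j /\ b j < a j.+1 &
         forall j, a j.+1 <= b j + gap],
      forall i, i < a 0 -> gd i,
      forall j i, b j <= i < a j.+1 -> gd i &
      forall d, g * \sum_(j < d.+1) (b j - a j) <= 3 * b d + C'].

(** The order of quantifiers matters: [c] will vary with n, but the interval indices and implied
    constants must not. *)
Lemma frame_exists : exists (jz : nat -> nat) (gap C' : nat),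
  (forall l, jz l < jz l.+1) /\
  forall c : nat -> nat, (forall l, 0 < c l <= k) ->
  exists a b : nat -> nat, separated_runs gap C' a b /\
    forall l, a (jz l) = (L l).+1 /\ b (jz l) = L l + e (c l).
Proof.
have K0 : ~~ K 0.
  apply/negP => /andP[/orP[h|/orP[h|/in_zoneP[l h]]] _]; last by lia.
    by move: h; rewrite inE gd0.
  by move: h; rewrite inE mod0n.
have Kinf p : exists2 q, p <= q & K q.
  by have [q pq Kq] := K_syndetic p; exists q => //; lia.
have nKinf p : exists2 q, p <= q & ~~ K q.
  exists (L p); first by move: (L_growth p); lia.
  by rewrite negb_and negbK; apply/orP; right; apply/cutP; exists p; left.
have nKL l : ~~ K (L l).
  by rewrite negb_and negbK; apply/orP; right; apply/cutP; exists l; left.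
have nKE l : ~~ K (L l + e 1).
  by rewrite negb_and negbK; apply/orP; right; apply/cutP; exists l; right.
have [a [b [a0 nKa ab Kab nKba]]] := runs_exist K0 Kinf nKinf.
have [e1 e2] := e_1k (leqnn 1) k_gt0.
have a_mono : {homo a : i j / i < j}.
  apply: homo_ltn => [|j]; first exact: ltn_trans.
  by have [] := ab j; apply: ltn_trans.
have b_mono : {homo b : i j / i < j}.
  apply: homo_ltn => [|j]; first exact: ltn_trans.
  by have [] := ab j.+1; have [_] := ab j; lia.
have a_ge j : j <= a j.
  by elim: j => // j IH; apply: leq_ltn_trans IH _; apply: a_mono.
have before_a j : ~~ K (a j).-1.
  case: j => [|j]; first by apply: nKa; rewrite prednK.
  by apply: (nKba j); have [_] := ab j; lia.
have run_at l : exists j, b j = L l + e 1.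
  have Kp : K (L l + e 1).-1 by apply: (@K_zone l); lia.
  set p := _.-1 in Kp; have pE : L l + e 1 = p.+1 by rewrite /p; lia.
  have ex : exists j, p < a j by exists p.+1; apply: a_ge.
  case: (ex_minnP ex) => [[|j]] pa jmin.
    by have := nKa _ pa; rewrite Kp.
  have ajp : a j <= p by rewrite leqNgt; apply/negP => /jmin; rewrite ltnn.
  exists j; rewrite pE.
  case: (ltngtP (b j) p.+1) => // hb.
    by have := nKba j p; rewrite Kp => /(_ ltac:(lia)).
  by have := Kab j p.+1; rewrite -pE (negPf (nKE l)) pE => /(_ ltac:(lia)).
(* In a zone only the cut lies outside [K], so one run fills the part before it and the next run
   continues past the end of the zone. *)
have zone_run l j : b j = L l + e 1 -> [/\ a j = (L l).+1, a j.+1 = (b j).+1 &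
    L l + W < b j.+1].
  move=> bE; have [ab1 ab2] := ab j; have [ab3 _] := ab j.+1.
  have aj1 : a j.+1 = (b j).+1.
    apply/eqP; rewrite eqn_leq ab2 andbT leqNgt; apply/negP => h.
    have := nKba j (b j).+1; rewrite h leqnSn => /(_ isT).
    by apply/negP; rewrite negbK; apply: (@K_zone l); lia.
  split=> //.
    apply/eqP; rewrite eqn_leq.
    apply/andP; split; rewrite leqNgt; apply/negP => h.
      by move: (before_a j); apply/negP; rewrite negbK; apply: (@K_zone l); lia.
    by move: (nKL l); apply/negP; rewrite negbK; apply: (Kab j); lia.
  rewrite ltnNge; apply/negP => h.
  have nKb : ~~ K (b j.+1) by apply: (nKba j.+1); have [_] := ab j.+1; lia.
  by move: nKb; apply/negP; rewrite negbK; apply: (@K_zone l); lia.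
have /choice[jz hjz] := run_at.
have jz_ltS l : jz l < jz l.+1.
  have : b (jz l) < b (jz l.+1).
    by rewrite !hjz; move: (L_gap l); lia.
  by case: (ltngtP (jz l) (jz l.+1)) => // [/b_mono|->]; lia.
exists jz, (maxn (a 0) (g.+2 + 1)), (C + g * W); split=> // c hc.
(* [s j] is how far the end of run j moves, taking the start of run j + 1 along. *)
have /choice[s hs] : forall j, exists s,
    (forall l, b j = L l + e 1 -> s = e (c l) - e 1) /\
    (s = 0 \/ exists l, b j = L l + e 1).
  move=> j; case: (pselect (exists l, b j = L l + e 1)) => [[l hl]|hn].
    exists (e (c l) - e 1); split; last by right; exists l.
    move=> l' hl'; congr (e (c _) - _).
    by apply: (@L_eq _ _ (e 1) (e 1)); lia.
  by exists 0; split; [move=> l hl; case: hn; exists l | left].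
have s_zone j : s j = 0 \/ exists l,
    [/\ b j = L l + e 1, b j + s j = L l + e (c l), a j = (L l).+1,
        a j.+1 = (b j).+1 & L l + W < b j.+1].
  have [h1 [->|[l hl]]] := hs j; [by left | right; exists l].
  have [? ? ?] := zone_run _ _ hl; split=> //; rewrite (h1 _ hl) hl.
  by have /andP[c0 ck] := hc l; have [] := e_1k c0 ck; lia.
have ce l : e 1 <= e (c l) /\ e (c l) < W.
  by have /andP[c0 ck] := hc l; apply: e_1k.
pose a' j := a j + (if j is i.+1 then s i else 0); pose b' j := b j + s j.
have ab' j : a' j < b' j /\ b' j < a' j.+1.
  rewrite /a' /b' ltn_add2r; have [lt1 lt2] := ab j; split=> //.
  case: j lt1 lt2 => [|j] lt1 lt2; first by lia.
  case: (s_zone j) => [->|[l [h1 h2 h3 h4 h5]]]; first by lia.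
  by move: (ce l); lia.
exists a', b'; split; first split.
- split=> //; first by rewrite /a' addn0.
    by rewrite /a' addn0 leq_maxl.
  move=> j; rewrite /a' /b' addnAC leq_add2r.
  have [q hq Kq] := K_syndetic (b j).
  apply: leq_trans (_ : b j + (g.+2 + 1) <= _).
    rewrite leqNgt; apply/negP => h.
    by have := nKba j q; rewrite Kq => /(_ ltac:(lia)).
  by rewrite leq_add2l leq_maxr.
- by move=> i; rewrite /a' addn0 => /nKa/not_K_good.
- move=> j i; rewrite /a' /b'; case: (s_zone j) => [->|[l [h1 h2 h3 h4 h5]]].
    by rewrite !addn0 => /nKba/not_K_good.
  have /andP[c0 ck] := hc l.
  (* The only position between the two moved runs is the new cut. *)
  by rewrite h4 h2 addSn h2 ltnS -eqn_leq => /eqP <-; apply: gdE.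
- move=> d; apply: leq_trans (full_count _).
  rewrite leq_mul2l; apply/orP; right; apply: sum_runs => // j i.
  rewrite /a' /b'; case: (s_zone j) => [->|[l [h1 h2 h3 h4 h5]]] hi.
    by have /andP[] : K i by apply: (Kab j); lia.
  apply/orP; right; apply/orP; right; apply/in_zoneP; exists l.
  by move: (ce l); lia.
- move=> l; have [aE aE' bE] := zone_run _ _ (hjz l).
  have [lt1 lt2] := ab (jz l).
  have [h1 _] := hs (jz l); rewrite /b' (h1 _ (hjz l)) hjz /a' aE.
  split; last by move: (ce l); lia.
  case: (jz l) aE => [|j] aE; first by rewrite addn0.
  case: (s_zone j) => [->|[l' [h1' h2' h3' h4' h5']]]; first by rewrite addn0.
  (* The start of this run does not move: otherwise [L l] would itself be the cut of a zone. *)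
  have ll : l = l' by apply: (@L_eq _ _ 0 (e 1)); lia.
  by subst l'; lia.
Qed.

End Frame.
End Runs.

(** * Intervals of positions *)

Section Intervals.
Local Open Scope nat_scope.

Definition itv p q : {fset nat} := seq_fset tt (iota p (q - p)).

Lemma mem_itv p q i : (i \in itv p q) = (p <= i < q).
Proof. by rewrite seq_fsetE mem_iota; apply/idP/idP; lia. Qed.

Lemma itv_neq0 p q : p < q -> itv p q != fset0.
Proof. by move=> pq; apply/fset0Pn; exists p; rewrite mem_itv leqnn. Qed.

Lemma itv_interval p q : is_interval (itv p q).
Proof. by move=> a b c; rewrite !mem_itv; lia. Qed.

Lemma itv_lt p q p' q' : q <= p' -> set_lt (itv p q) (itv p' q').
Proof. by move=> qp a b; rewrite !mem_itv; lia. Qed.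

Lemma card_itv p q : #|` itv p q| = q - p.
Proof. by rewrite size_seq_fset undup_id ?iota_uniq // size_iota. Qed.

(** The intervals are half-open, so the nearest points are [q.-1] and [p']. *)
Lemma itv_dist p q p' q' : p < q -> q <= p' -> p' < q' ->
  set_dist (itv p q) (itv p' q') = (p' - q).+1.
Proof.
move=> pq qp pq'; apply/eqP; rewrite eqn_leq; apply/andP; split.
  have := @set_dist_le (itv p q) (itv p' q') q.-1 p'.
  rewrite !mem_itv => /(_ ltac:(lia) ltac:(lia)) h; apply: leq_trans h _.
  by lia.
have [a [b []]] := set_dist_attained (itv_neq0 pq) (itv_neq0 pq').
by rewrite !mem_itv => ha hb ->; lia.
Qed.

Lemma sum_itv (V : nmodType) p q (F : nat -> V) :
  (\sum_(i <- itv p q) F i = \sum_(i <- iota p (q - p)) F i)%R.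
Proof.
apply: perm_big; rewrite (perm_trans (seq_fset_perm _ _)) //.
by rewrite undup_id ?iota_uniq.
Qed.

Lemma card_fset_bigU (r : seq nat) (F : nat -> {fset nat}) :
  #|` (\big[fsetU/fset0]_(j <- r) F j)%fset| <= \sum_(j <- r) #|` F j|.
Proof.
elim: r => [|j r IH]; first by rewrite !big_nil cardfs0.
by rewrite !big_cons (leq_trans (leq_card_fsetU _ _)) // leq_add2l.
Qed.

Lemma fset_max_ge (S : {fset nat}) i : i \in S -> i <= fset_max S.
Proof. by move=> iS; apply: (leq_bigmax_seq (F := id)). Qed.

End Intervals.

(** * Passage from letters in ['I_k] to natural numbers *)

Section KBonacciWord.
Local Open Scope nat_scope.

Lemma val_kbonacci_morphism k (hk : 2 <= k) (w : seq 'I_k) :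
  map val (kbonacci_morphism hk w) = morph k (map val w).
Proof.
rewrite /kbonacci_morphism /morph map_flatten -!map_comp; congr flatten.
apply: eq_map => a /=; rewrite /kbonacci_letter.
by case: insubP => [b h /= ->|/negPf h]; rewrite h.
Qed.

Lemma kbonacci_word_std k (hk : 2 <= k) (u : nat -> 'I_k) n :
  is_kbonacci_word hk u ->
  map (fun i => val (u i)) (iota 0 (len k n)) = std k n.
Proof.
move=> hu; have std_val m :
    std k m = map val (iter m (kbonacci_morphism hk) [:: letter0 hk]).
  by elim: m => //= m ->; rewrite -val_kbonacci_morphism.
have std_ext d : exists r, std k (n + d) = std k n ++ r.
  elim: d => [|d [r IH]]; first by exists [::]; rewrite addn0 cats0.
  by exists (r ++ img k (n + d) [:: 1]); rewrite addnS stdS // IH catA.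
apply: (@eq_from_nth _ 0) => [|i]; rewrite size_map size_iota // => it.
rewrite (nth_map 0) ?size_iota // nth_iota // add0n.
have [N hN] := hu i; have := hN (n + N) (leq_addl _ _).
have [r Er] := std_ext N.
move=> /(onth_nth (letter0 hk)) e.
have : nth 0 (std k (n + N)) i = nth 0 (std k n) i by rewrite Er nth_cat it.
move=> <-; rewrite std_val (nth_map (letter0 hk)) ?e // .
by rewrite -(size_map val) -std_val Er size_cat ltn_addr.
Qed.

End KBonacciWord.

(** * Choice of constants and verification of the four conditions *)

Local Open Scope ring_scope.

Theorem theorem12 (R : realType) (k : nat) (hk : (2 <= k)%N)
    (u : nat -> 'I_k) (hu : is_kbonacci_word hk u) :
  strongly_echoing R u.
Proof.
move=> eps eps0.
pose U i := val (u i).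
have U_lt i : (U i < k)%N by apply: ltn_ord.
have U_std n : map U (iota 0 (len k n)) = std k n.
  exact: kbonacci_word_std hu.
have k0 : (0 < k)%N by apply: ltnW.
pose q := Num.bound eps^-1.
have q0 : eps^-1 < q%:R by apply: archi_boundP; rewrite invr_ge0 ltW.
(* Runs get density 3 / (8q) up to a constant, absorbed by rounding 3 to 4; comparing lengths of
   letter images costs a factor 2, leaving 1 / q. *)
have [M M0 [C bad_le]] := bad_density hk U_lt U_std (8 * q).
pose pos := pos k U.
pose W := (len k (M + k)).+1.
(* Large enough for [L_gap], by [len_gap] and [len_gtn], and for k < m0 + l. *)
pose m0 := ((8 * q).+1 * W + k + 3)%N.
pose L l := len k (M + (m0 + l).+1).
pose e a := len k (M + a).
have gL l : good k U M (L l).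
  by rewrite /L -(pos_len U_std); apply: good_pos => //; apply: U_len.
have gE l a : (0 < a)%N -> (a <= k)%N -> good k U M (L l + e a).
  move=> a0 ak; have am : (a < m0 + l)%N by rewrite /m0; lia.
  rewrite /L /e -(pos_zone hk U_std M am); apply: good_pos => //.
  have h : ((len k a).+1 <= len k (m0 + l))%N.
    by apply: leq_trans (len_mono hk am); apply: len_ltS.
  have := congr1 (fun w => nth 0%N w (len k a)) (seg_len hk U_std h).
  by rewrite !nth_seg // add0n => ->; apply: U_len.
have good0 : good k U M 0.
  by rewrite -(pos0 k U M); apply: good_pos => //; apply: U0.
have e1 : (1 < e 1)%N by apply: leq_ltn_trans (len_gtn hk (M + 1)); lia.
have e_mono : {homo e : i j / (i <= j)%N}.
  by move=> i j ij; apply: len_mono; rewrite // leq_add2l.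
have L_gap l : (L l + (e k).+1 + 2 + (8 * q) * (e k).+1 <= L l.+1)%N.
  rewrite /L /e -/W (_ : M + (m0 + l.+1).+1 = (M + m0 + l).+2)%N; last by lia.
  rewrite (_ : M + (m0 + l).+1 = (M + m0 + l).+1)%N; last by lia.
  apply: leq_trans (len_gap hk _); rewrite -!addnA leq_add2l; apply: ltnW.
  apply: leq_ltn_trans (len_gtn hk _); rewrite /m0 mulSn; lia.
have [jz [gap [C' [jzS frame]]]] :=
  frame_exists k0 good0 gL gE e1 e_mono L_gap bad_le.
(* Zones 2i and 2i+1 are reserved for the algebraic number with code i. *)
have /choice[c hc] : forall nl : nat * nat, exists a,
  [/\ (0 < a)%N, (a <= k)%N &
    forall beta : algC, choice.unpickle nl.2./2 = Some beta -> 1 < `|beta| ->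
    forall m L, (k < m)%N -> L = len k (M + m.+1) ->
  \sum_(i <- iota (pos nl.1 L.+1)
      (pos nl.1 (L + len k (M + a)) - pos nl.1 L.+1))
    ((U (i + len k (nl.1 + M)))%:R - (U i)%:R) * beta^-1 ^+ i != 0].
  move=> [n l] /=.
  case: (choice.unpickle _) => [beta|]; last by exists 1%N; split.
  case: (boolP (1 < `|beta|)) => hb; last first.
    by exists 1%N; split=> // b [<-]; rewrite (negPf hb).
  have b0 : beta != 0 by rewrite -normr_gt0 (lt_trans ltr01).
  have x0 : beta^-1 != 0 by rewrite invr_eq0.
  have x1 j : (0 < j)%N -> beta^-1 ^+ j != 1.
    move=> j0; apply: contraTneq hb => /(congr1 Num.norm).
    rewrite exprVn normfV normrX normr1 => /(congr1 GRing.inv).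
    rewrite invrK invr1 => h; apply/negP => h'.
    by have := exprn_egt1 j h'; rewrite h ltxx -lt0n j0.
  have [a [a0 ak ha]] := zone_sum_neq0 hk U_std x0 x1 n M0.
  by exists a; split=> // b [<-] _; apply: ha.
have /choice[a ha] : forall n, exists a : nat -> nat, exists b : nat -> nat,
    separated_runs (good k U M) (8 * q) gap C' a b /\
    forall l, a (jz l) = (L l).+1 /\ b (jz l) = (L l + e (c (n, l)))%N.
  move=> n; apply: (frame (fun l => c (n, l))) => l.
  by have [-> ->] := hc (n, l).
have {ha} /choice[b hab] := ha.
(* Interval 0 is [0, 1) = {0}; interval j + 1 is the image of run j. *)
pose A n j := if j is j'.+1 then pos n (a n j') else 0%N.
pose B n j := if j is j'.+1 then pos n (b n j') else 1%N.
have AB n j : (A n j < B n j)%N.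
  case: j => // j; have [[[_ _ h _] _ _ _] _] := hab n.
  by apply: pos_lt => //; have [] := h j.
have BA n j : (B n j <= A n j.+1)%N.
  have [[[a0 _ h _] _ _ _] _] := hab n; case: j => [|j] /=.
    by apply: leq_trans a0 _; apply: pos_ge.
  by apply: pos_mono => //; apply: ltnW; have [] := h j.
exists (fun=> 0%N), (fun n => len k (n + M)).
exists (fun n j => itv (A n j) (B n j)); split.
  split=> [n|n|n j|n j]; first exact: len_gt0.
  - by apply/fsetP => i; rewrite mem_itv inE /=; case: i.
  - by split; [apply: itv_neq0 | apply: itv_interval].
  - exact: itv_lt.
split.
- move=> n p; rewrite addn0 => ne.
  have [i hi] := pos_inv hk U n p.
  have [[[_ _ h _] gooda goodj _] _] := hab n.
  have ngood : ~~ good k U M i.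
    apply: contra ne => gi; apply/eqP/val_inj.
    exact: (good_eq hk U_std gi hi).
  have ex : exists j, (i < a n j)%N.
    exists i.+1; elim: i.+1 => // j IH; apply: leq_ltn_trans IH _.
    by have [h1 h2] := h j; apply: ltn_trans h2.
  case: (ex_minnP ex) => [[|j]] ia jmin; first by rewrite gooda in ngood.
  have aji : (a n j <= i)%N.
    by rewrite leqNgt; apply/negP => /jmin; rewrite ltnn.
  case: (ltnP i (b n j)) => ib; last by rewrite (goodj j) ?ib // in ngood.
  exists j.+1 => //; rewrite mem_itv; case/andP: hi => h1 h2; apply/andP; split.
    by apply: leq_trans h1; apply: pos_mono.
  by apply: leq_trans h2 _; apply: pos_mono.
- exists (C' + 6)%N, 0%N => [[|d] n hd _]; first by lia.
  have [[[_ _ h _] _ _ hsum] _] := hab n.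
  set S := (\big[fsetU/fset0]_(1 <= j < d.+2) itv (A n j) (B n j))%fset.
  have bd : (d < b n d)%N.
    elim: d {hd S} => [|d IH]; first by have [] := h 0%N; lia.
    by have [h1 h2] := h d; have [h3 _] := h d.+1; lia.
  have T0 := len_gt0 hk n.
  have cardS : (#|` S| <= len k n * \sum_(j < d.+1) (b n j - a n j))%N.
    apply: leq_trans (card_fset_bigU _ _) _.
    rewrite big_add1 /= big_mkord big_distrr /=; apply: leq_sum => j _.
    rewrite card_itv /=; have [/ltnW/subnKC <- _] := h j.
    by have := pos_leD k U n (a n j) (b n j - a n j); rewrite -/pos; lia.
  have maxS : ((pos n (b n d)).-1 <= fset_max S)%N.
    apply: fset_max_ge; apply/bigfcupP; exists d.+1.
      by rewrite mem_index_iota /= andbT; lia.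
    rewrite mem_itv /=; have := AB n d.+1; rewrite /=; lia.
  have posb : ((b n d).-1 * len k n <= 2 * fset_max S)%N.
    have := pos_geD hk U n 0 (b n d).-1; rewrite pos0 add0n muln0 add0n.
    move=> h1; apply: leq_trans h1 _; rewrite leq_mul2l /=.
    apply: leq_trans maxS.
    have := pos_ltS hk U n (b n d).-1; rewrite prednK -/pos; lia.
  have qS : (q * #|` S| <= fset_max S)%N.
    have hs := hsum d.
    have h1 : (2 * q * \sum_(j < d.+1) (b n j - a n j) <= (b n d).-1)%N by lia.
    have h2 := leq_mul (leqnn (2 * q)) cardS.
    have h3 := leq_mul (leqnn (len k n)) h1.
    by lia.
  have max0 : (0 < fset_max S)%N.
    have : (0 < (b n d).-1 * len k n)%N by rewrite muln_gt0 T0; lia.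
    by lia.
  rewrite /den ler_pdivrMr ?ltr0n //.
  have : (q * #|` S|)%:R <= (fset_max S)%:R :> R by rewrite ler_nat.
  rewrite natrM => h1; have h2 : 1 <= eps * q%:R.
    by rewrite -ler_pdivrMl // mulr1 ltW.
  apply: le_trans (_ : eps * (q%:R * (#|` S|)%:R) <= _).
    by rewrite mulrA ler_peMl.
  by rewrite ler_pM2l.
- have T0 n := len_gt0 hk n.
  have dist n j : set_dist (itv (A n j) (B n j)) (itv (A n j.+1) (B n j.+1)) =
      (A n j.+1 - B n j).+1 by apply: itv_dist.
  split=> [n||]; first by rewrite addSn; apply: len_ltS.
    by exists 1%N, 1; split=> // n _; rewrite subr0 mul1r.
  split.
    (* A gap consists of at most [gap] letter images, each of length at most [len n]; the extra 1
       covers the successor in [dist]. *)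
    exists 1%N, (gap.+1)%:R; split; rewrite ?ltr0n // => j n _.
    rewrite -natrM ler_nat dist.
    apply: leq_trans (_ : gap.+1 * len k n <= _)%N; last first.
      by rewrite leq_mul2l len_mono ?leq_addr ?orbT.
    have [[[h1 h2 _ h3] _ _ _] _] := hab n.
    rewrite mulSn; case: j => [|j] /=.
      have := pos_leD k U n 0 (a n 0%N); rewrite pos0 !add0n -/pos => h4.
      have := leq_mul h2 (leqnn (len k n)); have := T0 n; lia.
    have h4 : (pos n (a n j.+1) <= pos n (b n j) + gap * len k n)%N.
      by apply: leq_trans (pos_leD _ _ _ _ _) => //; apply: pos_mono.
    by have := T0 n; lia.
  (* A gap contains a letter image, of length at least [len n] / 2, while s_n <= 2^M [len n]. *)
  exists 1%N, (2 ^ M.+1)%:R; split; rewrite ?ltr0n ?expn_gt0 // => j n _.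
  rewrite -natrM ler_nat dist.
  apply: leq_trans (len_leD hk n M) _.
  rewrite expnSr -mulnA leq_mul2l; apply/orP; right.
  have [[[h1 h2 h _] _ _ _] _] := hab n; case: j => [|j] /=.
    have := pos_geD hk U n 0 (a n 0%N); rewrite pos0 muln0 !add0n -/pos.
    by have := leq_mul h1 (leqnn (len k n)); lia.
  have [_ h4] := h j.
  have := pos_geD hk U n (b n j) 1.
  have : (pos n (b n j + 1) <= pos n (a n j.+1))%N.
    by apply: pos_mono => //; lia.
  by rewrite -/pos; lia.
(* Each zone provides one interval, so the two indices come from the two zones reserved for
   [beta]. *)
- move=> beta hb; pose l0 := (choice.pickle beta).*2.
  exists (jz l0).+1, (jz l0.+1).+1; split=> [//||n j hj].
    by rewrite ltnS; apply: jzS.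
  have [l [lE ->]] : exists l, l./2 = choice.pickle beta /\ j = (jz l).+1.
    case: hj => ->; [exists l0 | exists l0.+1]; split=> //; rewrite /l0.
      by rewrite doubleK.
    by rewrite -[_.+1]/(true + _)%N half_bit_double.
  have [_ _ hn] := hc (n, l).
  have := hn beta; rewrite /= lE choice.pickleK.
  move=> /(_ erefl hb (m0 + l)%N (L l)).
  have km : (k < m0 + l)%N by rewrite /m0; lia.
  move=> /(_ km erefl); rewrite sum_itv /=.
  have [_ hz] := hab n; have [-> ->] := hz l.
  congr (_ != 0); apply: eq_bigr => i _.
  by rewrite addn0 exprVn.
Qed.
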